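(* Let $t(n,k)$ be the number of paths in $\mathcal{M}'_2$ of length $n$ whose end-point has height $k$. Then, for $n,k\ge0$, $$t(n,k)=\begin{cases} [k=0]& \text{if } n=0,\\ r(n-1,k)&\text{otherwise,}\end{cases}$$ where $$r(n,k)=\sum_{i=0}^n\frac{m_i\cdot (k+[n=i])}{n+k-i+[n=i]}\sum_{j=0}^{n-i}(-1)^{n-i-j}\binom{n+k-i+j-1}{j}\sum_{\ell=0}^{n+k-i}\binom{n+k-i}{\ell}\binom{\ell}{n-i-j-\ell}$$ and $m_n=\sum_{k=0}^{\lfloor n/2\rfloor}\binom{n}{2k}c_k$ is the $n$-th Motzkin number, with $c_k=\frac{1}{k+1}\binom{2k}{k}$.
   Context: $\mathcal{M}'_2$ is the set of lattice paths in $\mathbb{N}^2$ (with $\mathbb{N}=\{0,1,2,\dots\}$, so paths never go below the $x$-axis) starting at the origin, made of up steps $(1,k)$ with $k\ge 1$, down steps $(1,-1)$ and horizontal steps $(1,0)$, in which every up step and every horizontal step, except possibly when it is the first step of the path, is immediately preceded by a down step. The empty path belongs to $\mathcal{M}'_2$. The length of a path is its number of steps; the height of a point is its ordinate. $[P]$ is $1$ if $P$ holds and $0$ otherwise. Conventions: for integers $a,b$, $\binom{a}{b}=a(a-1)\cdots(a-b+1)/b!$ if $b\ge0$ (so $\binom{-1}{0}=1$) and $\binom{a}{b}=0$ if $b<0$. *)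

(* Defs.v *)
From mathcomp Require Import all_boot all_order all_algebra finmap.
From mathcomp Require Import mathcomp_extra boolp classical_sets functions cardinality.

Set Implicit Arguments.
Unset Strict Implicit.
Unset Printing Implicit Defensive.

Import Order.TTheory GRing.Theory Num.Theory.
Local Open Scope ring_scope.

(* Every step has abscissa 1, so a lattice path from the origin is encoded by
   the sequence of the ordinates of its steps: the step (1, s) is the integer s,
   and the length of the path is the size of the sequence. *)
Definition lpath := seq int.

Definition up_step (s : int) : bool := 0 < s.
Definition down_step (s : int) : bool := s == -1.
Definition horizontal_step (s : int) : bool := s == 0.

(* ordinate of the point reached after the first i steps *)
Definition height (p : lpath) (i : nat) : int := \sum_(s <- take i p) s.

Definition end_height (p : lpath) : int := height p (size p).

Definition in_M2' (p : lpath) : Prop :=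
  [/\ forall s, s \in p -> [|| up_step s, down_step s | horizontal_step s],
      forall i, (i <= size p)%N -> 0 <= height p i
    & forall i, (i.+1 < size p)%N ->
        up_step (nth 0 p i.+1) || horizontal_step (nth 0 p i.+1) ->
        down_step (nth 0 p i)].

Definition M2'_paths (n k : nat) : set lpath :=
  [set p | [/\ in_M2' p, size p = n & end_height p = k%:Z]]%classic.

Definition t (n k : nat) : nat := #|` fset_set (M2'_paths n k)|%fset.

(* fset_set sends infinite sets to the empty fset; this does not occur in t. *)
Lemma finite_M2'_paths (n k : nat) : finite_set (M2'_paths n k).
Proof.
pose f (u : n.-tuple 'I_(n + k).+1) : lpath := [seq (val i)%:Z - 1 | i <- u].
apply: (@sub_finite_set _ _ (f @` [set: n.-tuple 'I_(n + k).+1])%classic);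
  last exact/finite_image/finite_finset.
move=> p [[steps _ _] szp hp].
have ge0 s : s \in p -> 0 <= s + 1.
  by move/steps/or3P => -[/ltW s0|/eqP->|/eqP->] //; rewrite addr_ge0.
have sum1 : \sum_(s <- p) (s + 1) = (n + k)%N%:Z.
  rewrite big_split /= big_const_seq count_predT szp iter_addr_0.
  by move: hp; rewrite /end_height /height take_size => ->; rewrite addrC natz PoszD.
have le s : s \in p -> s + 1 <= (n + k)%N%:Z.
  move=> sp; rewrite -sum1 (perm_big _ (perm_to_rem sp)) big_cons /= lerDl.
  by rewrite big_seq sumr_ge0 // => x /mem_rem /ge0.
have szq : size [seq inord (absz (s + 1)) : 'I_(n + k).+1 | s <- p] == n.
  by rewrite size_map szp.
exists (Tuple szq) => //; rewrite /f /= -map_comp -[RHS]map_id.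
apply/eq_in_map => s sp /=; rewrite inordK.
  by rewrite gez0_abs ?ge0 // addrK.
by rewrite ltnS -lez_nat gez0_abs ?ge0 // le.
Qed.

(* Generalized binomial coefficient: the top may be negative, and a negative
   bottom gives 0. *)
Definition binomz (a b : int) : rat :=
  match b with
  | Posz b' => (\prod_(i < b') (a - i%:Z))%:~R / (b'`!)%:R
  | Negz _ => 0
  end.

Definition catalan (k : nat) : rat := (k.+1)%:R^-1 * binomz (2 * k)%N k.

Definition motzkin (n : nat) : rat :=
  \sum_(0 <= k < (n %/ 2).+1) binomz n (2 * k)%N * catalan k.

Definition r (n k : nat) : rat :=
  \sum_(0 <= i < n.+1)
    motzkin i * (k + (n == i))%N%:R / (n + k - i + (n == i))%N%:R *
    \sum_(0 <= j < (n - i).+1)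
      (-1) ^+ (n - i - j) *
      binomz (n%:Z + k%:Z - i%:Z + j%:Z - 1) j *
      \sum_(0 <= l < (n + k - i).+1)
        binomz (n%:Z + k%:Z - i%:Z) l *
        binomz l (n%:Z - i%:Z - j%:Z - l%:Z).

(* Main.v *)
Require Import Defs.
From mathcomp Require Import all_boot all_order all_algebra.
From mathcomp Require Import finmap boolp classical_sets cardinality.
From mathcomp Require Import zify ring.
Import GRing.Theory Num.Theory.
Local Open Scope ring_scope.

(** Write [x^n] F for a coefficient of a power series F, let
    phi = 1 + x^2/(1-x) = (1-x+x^2)/(1-x), let V be the power series with
    V = phi(xV), and let M be the generating function of the Motzkin numbers.

    The formula says that r(n,k) = [x^n] M V^k.  Indeed Lagrange inversion gives
    [x^N] V^k = k/(N+k) [x^N] phi^(N+k), and the two inner sums of r are the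
    expansion of [x^N] phi^A, with N = n-i and A = N+k, according to
    phi^A = (1-x)^(-A) (1-x+x^2)^A ([inner_sumE]).

    On the side of paths, remove the last step.  If it is a down step, what
    remains is a path ending one level higher.  If not, and if the path has at
    least two steps, it is preceded by a down step that ends at some height
    h <= k, and h determines the last step.  Hence
      t(n+2,k) = t(n+1,k+1) + sum_(h <= k) t(n,h+1)     ([t_rec]).
    Subtracting this relation for two consecutive values of k leaves a linear
    recurrence [V_rec], which is also satisfied by [x^n] M V^k since
      V^(k+1) - V^k = x (V^(k+2) - V^(k+1)) + x^2 V^(k+2)
    is V^k times the equation V = phi(xV), cleared of its denominator 1 - xV.

    The proof works with the arrays that Lagrange inversion predicts for the
    powers of V.  With H = phi - x phi', they are
      [x^n] H phi^(n+k-1)       for [x^n] V^k      ([V_coef]),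
      [x^n] H/(1-x) phi^(n+k)   for [x^n] M V^k    ([MV_coef]),
    and any array [x^n] G phi^(n+k+c) satisfies [V_rec], because
    phi - 1 = x (phi - 1) + x^2.  The factor H is tied to the coefficient k/(N+k)
    by A [x^N] phi^(A-1) (phi - x phi') = (A-N) [x^N] phi^A, where x d/dx
    multiplies the coefficient of x^N by N ([lagrange_coef]).

    A solution of [V_rec] is determined by its rows 0 and 1 and its column k = 0
    ([V_rec_uniq]).  The column of [MV_coef] is the Motzkin sequence
    ([MV_coef_motzkin]), as is that of r, so r = [MV_coef].  It also satisfies
    the recurrence [t_rec] at k = 0, so the array t(n+1,k) = [MV_coef] too.

    Power series are represented by polynomials: a bound K is chosen above all
    the indices in use, 1/(1-x) becomes 1 + x + ... + x^(K-1), and the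
    identities hold for the coefficients of index less than K. *)

(** * The series phi and its powers *)

Definition geom (K : nat) : {poly rat} := \poly_(i < K) 1.

Definition phi (K : nat) : {poly rat} := geom K * (1 - 'X + 'X^2).

Lemma geomE (K : nat) : (1 - 'X) * geom K = 1 - 'X^K.
Proof.
rewrite -[RHS]opprB subrX1 -mulNr opprB; congr (_ * _).
by rewrite /geom poly_def; apply: eq_bigr => i _; rewrite scale1r.
Qed.

Lemma coef_geom_mul (K n : nat) (Q : {poly rat}) :
  (n < K)%N -> ((1 - 'X) * geom K * Q)`_n = Q`_n.
Proof. by move=> nK; rewrite geomE mulrBl mul1r coefB coefXnM nK subr0. Qed.

Lemma coef_geomX (K A j : nat) : (j < K)%N ->
  (geom K ^+ A)`_j = 'C((A + j).-1, j)%:R.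
Proof.
elim: A j => [|A IHA] j.
  by move=> _; rewrite expr0 coef1 add0n; case: j => [//|j]; rewrite bin_small.
(* F^(A+1) = F^A + x F^(A+1) for F = 1/(1-x): Pascal's rule *)
have rec i : (i < K)%N ->
    (geom K ^+ A.+1)`_i = (geom K ^+ A)`_i + ('X * geom K ^+ A.+1)`_i.
  move=> iK; rewrite -(@coef_geom_mul K i (geom K ^+ A)) // -coefD.
  by congr ((polyseq _)`_i); rewrite exprS; ring.
elim: j => [|j IHj] jK; rewrite rec // IHA // coefXM.
  by rewrite /= !bin0 addr0.
rewrite /= IHj ?(ltnW jK) //= -natrD; congr (_%:R).
by rewrite ?addSn ?addnS /= ?addSn ?addnS /= binS.
Qed.

Lemma coef_phi01 (K : nat) : (1 < K)%N -> (phi K)`_0 = 1 /\ (phi K)`_1 = 0.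
Proof.
move=> K1.
have c i : (i < K)%N -> (geom K)`_i = 1 by move=> iK; rewrite coef_poly iK.
rewrite /phi mulrDr mulrBr mulr1 -[_ * 'X^2]mulrC -[_ * 'X]mulrC.
by rewrite !coefD !coefN !coefXM !coefXnM /= !c ?(ltnW K1) //; split; ring.
Qed.

Lemma coef_phiX01 (K A : nat) : (1 < K)%N ->
  (phi K ^+ A)`_0 = 1 /\ (phi K ^+ A)`_1 = 0.
Proof.
move=> K1; have [p0 p1] := coef_phi01 K K1.
elim: A => [|A [IH0 IH1]]; first by rewrite expr0 !coef1.
rewrite exprS !coefM !big_ord_recr !big_ord0 /= !subn0 subnn p0 p1 IH0 IH1.
by split; ring.
Qed.

(** This is phi - 1 = x (phi - 1) + x^2, multiplied by G phi^B. *)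
Lemma phiX_rec (K : nat) (G : {poly rat}) (B n : nat) : (n.+2 < K)%N ->
  (G * phi K ^+ B.+1)`_n.+2 = (G * phi K ^+ B)`_n.+2 +
    ((G * phi K ^+ B.+1)`_n.+1 - (G * phi K ^+ B)`_n.+1) + (G * phi K ^+ B)`_n.
Proof.
move=> nK; set Q := G * phi K ^+ B.
have E : Q * (phi K - 1) =
    'X * (Q * (phi K - 1)) + 'X^2 * Q - 'X^K * (Q * (1 - 'X + 'X^2)).
  have -> : 'X^K = 1 - (1 - 'X) * geom K :> {poly rat} by rewrite geomE; ring.
  by rewrite /phi; move: Q => Q; ring.
have QphiE : G * phi K ^+ B.+1 = Q * (phi K - 1) + Q.
  by rewrite exprSr /Q; ring.
rewrite QphiE !coefD {1}E coefB coefD coefXM coefXnM coefXnM nK /= subn2 /=.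
by ring.
Qed.

(** * The inner sums as coefficients of powers of phi *)

Lemma binomz_nat (a b : nat) : binomz a b = 'C(a, b)%:R.
Proof.
have b0 : b`!%:R != 0 :> rat by rewrite pnatr_eq0 -lt0n fact_gt0.
apply: (canLR (mulfK b0)); rewrite -natrM bin_ffact.
suff -> : \prod_(i < b) (a%:Z - i%:Z) = (a ^_ b)%:Z by [].
case: (ltnP a b) => [ab | ba].
  by rewrite ffact_small // (bigD1 (Ordinal ab)) //= subrr mul0r.
rewrite ffact_prod -[RHS]natz natr_prod; apply: eq_bigr => i _.
by rewrite natz subzn // ltnW // (leq_trans (ltn_ord i)).
Qed.

(** For A = j = 0 the top of the left-hand side is -1, whereas the predecessor
    on the right is 0; both coefficients are 1. *)
Lemma binomz_rising (A j : nat) :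
  binomz (A%:Z + j%:Z - 1) j = 'C((A + j).-1, j)%:R.
Proof.
case E : (A + j)%N => [|m]; rewrite ?succnK.
  have [-> ->] : A = 0%N /\ j = 0%N by lia.
  by rewrite /binomz big_ord0 /= divr1.
by rewrite -binomz_nat; congr (binomz _ _%:Z); lia.
Qed.

Lemma coef_1BXn (R : comNzRingType) (l m : nat) :
  ((1 - 'X : {poly R}) ^+ l)`_m = (-1) ^+ m * 'C(l, m)%:R.
Proof.
elim: l m => [|l IHl] m.
  by rewrite expr0 coef1; case: m => [|m]; rewrite ?mulr1 // bin0n mulr0.
rewrite exprS mulrBl mul1r coefB coefXM IHl; case: m => [|m] /=.
  by rewrite !bin0 subr0.
by rewrite IHl binS natrD exprS; ring.
Qed.

Lemma coef_1BXX2n (A M : nat) :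
  ((1 - 'X + 'X^2 : {poly rat}) ^+ A)`_M =
    (-1) ^+ M * \sum_(0 <= l < A.+1) binomz A l * binomz l (M%:Z - l%:Z).
Proof.
have -> : 1 - 'X + 'X^2 = 1 - 'X * (1 - 'X) :> {poly rat} by ring.
rewrite exprBn coef_sum mulr_sumr big_mkord; apply: eq_bigr => l _.
rewrite expr1n mulr1 exprMn coefMn.
rewrite binomz_nat -[LHS]mulr_natl [RHS]mulrCA; congr (_ * _).
have -> : (-1) ^+ l = ((-1) ^+ l)%:P :> {poly rat}.
  by rewrite rmorphXn /= rmorphN1.
rewrite coefCM coefXnM; case: ltnP => [Ml|lM].
  rewrite mulr0; have -> : M%:Z - l%:Z = Negz (l - M).-1 by lia.
  by rewrite /= mulr0.
have -> : M%:Z - l%:Z = (M - l)%N by lia.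
by rewrite binomz_nat coef_1BXn mulrA -exprD subnKC.
Qed.

Lemma inner_sumE (K N A : nat) : (N < K)%N ->
  \sum_(0 <= j < N.+1) (-1) ^+ (N - j) * binomz (A%:Z + j%:Z - 1) j *
     \sum_(0 <= l < A.+1) binomz A l * binomz l (N%:Z - j%:Z - l%:Z) =
  (phi K ^+ A)`_N.
Proof.
move=> NK; rewrite /phi exprMn coefM big_mkord; apply: eq_bigr => j _.
have jN := ltn_ord j.
rewrite coef_geomX; last by apply: leq_ltn_trans NK; rewrite -ltnS.
rewrite coef_1BXX2n binomz_rising [_ * 'C(_, _)%:R]mulrC -mulrA.
by have -> : (N - j)%N%:Z = N%:Z - j%:Z by lia.
Qed.

(** * The arrays of Lagrange inversion *)

(** Both sides compute the coefficient of x^N in the derivation x d/dx applied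
    to g F^(A+1); with g = 1 this is the computational content of Lagrange
    inversion. *)
Lemma lagrange_coef (R : comNzRingType) (g F : {poly R}) (A N : nat) :
  A.+1%:R * (g * (F - 'X * F^`()) * F ^+ A)`_N =
  (A.+1%:R - N%:R) * (g * F ^+ A.+1)`_N + ('X * g^`() * F ^+ A.+1)`_N.
Proof.
have D p : ('X * p^`())`_N = N%:R * p`_N :> R.
  by rewrite coefXM; case: N => [|N] /=; rewrite ?mul0r // coef_deriv mulr_natl.
rewrite mulrBl -D -coefCM -[_ * _`_N]coefCM -coefB -coefD.
congr ((polyseq _)`_N).
rewrite derivM deriv_exp /= -[F^`() * _ *+ _]mulr_natl -polyC_natr exprS.
by ring.
Qed.

Definition lagr (K : nat) : {poly rat} := phi K - 'X * (phi K)^`().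

(** The coefficient of x^n in V^k.  For n = k = 0 the exponent should be -1, but
    the constant terms of phi and [lagr] are 1 and the value is 1 as well. *)
Definition V_coef (K n k : nat) : rat := (lagr K * phi K ^+ (n + k).-1)`_n.

(** The coefficient of x^n in M V^k. *)
Definition MV_coef (K n k : nat) : rat :=
  (geom K * lagr K * phi K ^+ (n + k))`_n.

(** The relation V = phi(xV) with its denominator 1 - xV cleared, multiplied by
    V^k and read on the coefficient of x^(n+2). *)
Definition V_rec (K : nat) (a : nat -> nat -> rat) : Prop :=
  forall n k, (n.+2 < K)%N ->
    a n.+2 k.+1 = a n.+2 k + (a n.+1 k.+2 - a n.+1 k.+1) + a n k.+2.

Lemma V_coef_rec (K : nat) : V_rec K (V_coef K).
Proof.
by move=> n k nK; rewrite /V_coef !addnS !addSn /=; exact: phiX_rec.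
Qed.

Lemma MV_coef_rec (K : nat) : V_rec K (MV_coef K).
Proof.
by move=> n k nK; rewrite /MV_coef !addnS !addSn /=; exact: phiX_rec.
Qed.

(** The recurrence gives the entry (n+2,k+1) from the entry on its left and from
    earlier rows.  Column 0 may itself depend on the earlier rows, which is the
    case for the count of paths. *)
Lemma V_rec_uniq (K : nat) (a b : nat -> nat -> rat) :
  V_rec K a -> V_rec K b ->
  (forall k, a 0 k = b 0 k) -> (forall k, a 1 k = b 1 k) ->
  (forall n, (n.+2 < K)%N -> (forall i k, (i < n.+2)%N -> a i k = b i k) ->
     a n.+2 0%N = b n.+2 0%N) ->
  forall n k, (n < K)%N -> a n k = b n k.
Proof.
move=> ra rb ab0 ab1 abS n.
elim/ltn_ind: n => -[//|[//|n]] IHn k nK.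
have IH i l : (i < n.+2)%N -> a i l = b i l.
  by move=> lti; apply: IHn => //; apply: ltn_trans nK.
by elim: k => [|k IHk]; [exact: abS | rewrite ra // rb // IHk !IH].
Qed.

Lemma coef_lagr01 (K : nat) : (1 < K)%N -> (lagr K)`_0 = 1 /\ (lagr K)`_1 = 0.
Proof.
move=> K1; have [p0 p1] := coef_phi01 K K1.
by rewrite /lagr !coefB !coefXM /= coef_deriv p0 p1; split; ring.
Qed.

Lemma V_coef01 (K k : nat) : (1 < K)%N -> V_coef K 0 k = 1 /\ V_coef K 1 k = 0.
Proof.
move=> K1; have [l0 l1] := coef_lagr01 K K1; rewrite /V_coef.
have p0 A := (coef_phiX01 K A K1).1; have p1 A := (coef_phiX01 K A K1).2.
rewrite !coefM !big_ord_recr !big_ord0 /= !subn0 subnn !p0 p1 l0 l1.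
by split; ring.
Qed.

Lemma MV_coef01 (K k : nat) : (1 < K)%N ->
  MV_coef K 0 k = 1 /\ MV_coef K 1 k = 1.
Proof.
move=> K1; have [l0 l1] := coef_lagr01 K K1; rewrite /MV_coef.
have p0 A := (coef_phiX01 K A K1).1; have p1 A := (coef_phiX01 K A K1).2.
have g0 : (geom K)`_0 = 1 by rewrite coef_poly ltnW.
have g1 : (geom K)`_1 = 1 by rewrite coef_poly K1.
rewrite -!mulrA !coefM !big_ord_recr !big_ord0 /=.
rewrite ?coefM ?big_ord_recr ?big_ord0 /= !subn0 ?subnn !p0 p1 l0 l1 g0 g1.
by split; ring.
Qed.

Lemma V_coefE (K n k : nat) :
  (n + k)%:R * V_coef K n k = k%:R * (phi K ^+ (n + k))`_n.
Proof.
rewrite /V_coef; case E : (n + k)%N => [|A].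
  have [-> ->] : n = 0%N /\ k = 0%N by lia.
  by rewrite !mul0r.
have -> : k%:R = A.+1%:R - n%:R :> rat by rewrite -E natrD addrC addKr.
have := lagrange_coef _ 1 (phi K) A n.
by rewrite !mul1r derivC mulr0 mul0r coef0 addr0.
Qed.

Lemma V_coef_col0 (K n : nat) : V_coef K n.+1 0 = 0.
Proof.
have /eqP := V_coefE K n.+1 0.
by rewrite mul0r mulf_eq0 addn0 pnatr_eq0 /= => /eqP.
Qed.

(** The case k = 0 of the path recurrence.  With G = H/(1-x), it says that
    G phi^(n+1) (phi - x phi - x^2) = G phi^(n+1) (1-x) = H phi^(n+1) has no
    term in x^(n+2): this coefficient is that of V^0. *)
Lemma MV_coef_base_rec (K n : nat) : (n.+2 < K)%N ->
  MV_coef K n.+2 0 = MV_coef K n.+1 1 + MV_coef K n 1.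
Proof.
move=> nK; rewrite /MV_coef !addn0 !addn1.
set H := lagr K; set g := geom K.
have H0 : (H * phi K ^+ n.+1)`_n.+2 = 0.
  by rewrite -[RHS](V_coef_col0 K n.+1) /V_coef addn0.
apply/eqP; rewrite -subr_eq0 -[X in _ == X]H0; apply/eqP.
have <- := coef_geom_mul K n.+2 (H * phi K ^+ n.+1) nK.
have -> : (g * H * phi K ^+ n.+2)`_n.+1 = ('X * (g * H * phi K ^+ n.+2))`_n.+2.
  by rewrite coefXM.
have -> : (g * H * phi K ^+ n.+1)`_n = ('X^2 * (g * H * phi K ^+ n.+1))`_n.+2.
  by rewrite coefXnM /= subn2.
rewrite -coefD -coefB.
have -> : g * H * phi K ^+ n.+2 -
     ('X * (g * H * phi K ^+ n.+2) + 'X^2 * (g * H * phi K ^+ n.+1)) =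
   (1 - 'X) * g * (H * phi K ^+ n.+1) -
     'X^K * ((1 - 'X + 'X^2) * g * H * phi K ^+ n.+1).
  have -> : 'X^K = 1 - (1 - 'X) * g :> {poly rat} by rewrite geomE; ring.
  rewrite [phi K ^+ n.+2]exprS; move: (phi K ^+ n.+1) => F.
  by rewrite /phi -/g; ring.
by rewrite coefB coefXnM nK subr0.
Qed.

(** * The Motzkin numbers as column 0 *)

(** Both sides are (n+1)! / (l! (l+1)! (n-2l)!). *)
Lemma motzkin_term (n l : nat) : (l.*2 <= n)%N ->
  n.+1%:R * (binomz n (2 * l)%N * catalan l) =
  'C(n.+1, l)%:R * 'C(n.+1 - l, n - 2 * l)%:R.
Proof.
move=> ln; rewrite /catalan !binomz_nat mul2n.
have [d def_n] : exists d, n = (l.*2 + d)%N.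
  by exists (n - l.*2)%N; rewrite subnKC.
have f0 m : m`!%:R != 0 :> rat by rewrite pnatr_eq0 -lt0n fact_gt0.
have binE a b : 'C(a + b, a)%:R = (a + b)`!%:R / (a`!%:R * b`!%:R) :> rat.
  apply: (canRL (mulfK _)); first by rewrite mulf_neq0.
  by rewrite -!natrM -{2}(addKn a b) bin_fact ?leq_addr.
have -> : n = (l.*2 + d)%N by [].
have -> : (l.*2 + d - l.*2)%N = d by rewrite addKn.
have -> : ((l.*2 + d).+1 - l)%N = (d + l.+1)%N by lia.
rewrite binE binE -[in l.*2]addnn binE.
have -> : 'C((l + l + d).+1, l) = 'C(l + (d + l.+1), l).
  by congr ('C(_, l)); lia.
rewrite binE; have -> : (l + (d + l.+1))%N = (l + l + d).+1 by lia.
rewrite [(l + l + d).+1`!]factS [l.+1`!]factS !natrM.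
have l1 : l.+1%:R != 0 :> rat by rewrite pnatr_eq0.
have fl := f0 l; have fd := f0 d.
have fll := f0 (l + l)%N; have fdl := f0 (d + l.+1)%N.
move: l1 fl fd fll fdl; move: (l.+1%:R : rat) => x.
move: (l`!%:R : rat) (d`!%:R : rat) ((l + l)`!%:R : rat).
move: ((d + l.+1)`!%:R : rat).
by move=> ? ? ? ? ? ? ? ? ?; field; repeat (apply/andP; split => //).
Qed.

(** By [lagrange_coef] with g = 1/(1-x), for which g + x g' = 1/(1-x)^2, n+1
    times the left-hand side is [x^n] phi^(n+1)/(1-x)^2; expanding
    (1-x+x^2)^(n+1) in powers of 1-x and x^2 gives the defining sum of the
    Motzkin numbers term by term. *)
Lemma MV_coef_motzkin (K n : nat) : (n < K)%N -> MV_coef K n 0 = motzkin n.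
Proof.
move=> nK; have n1 : n.+1%:R != 0 :> rat by rewrite pnatr_eq0.
apply: (mulfI n1); rewrite /MV_coef addn0 lagrange_coef.
have -> : (n.+1%:R - n%:R) * (geom K * phi K ^+ n.+1)`_n
       + ('X * (geom K)^`() * phi K ^+ n.+1)`_n
   = (geom K ^+ 2 * phi K ^+ n.+1)`_n.
  rewrite -addn1 natrD addrAC subrr add0r mul1r -coefD -mulrDl.
  rewrite !coefM; apply: eq_bigr => i _; congr (_ * _).
  have iK : (i < K)%N by apply: leq_ltn_trans nK; rewrite -ltnS.
  rewrite coef_geomX // coefD coefXM; case: (i : nat) iK => [|j] jK /=.
    by rewrite coef_poly jK addr0.
  by rewrite coef_deriv !coef_poly jK binSn -mulrS.
rewrite /phi exprMn mulrA -exprD exprDn mulr_sumr coef_sum.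
rewrite /motzkin mulr_sumr big_mkord.
have term l : (l <= n.+1)%N -> (geom K ^+ (2 + n.+1) *
     ((1 - 'X) ^+ (n.+1 - l) * 'X^2 ^+ l *+ 'C(n.+1, l)))`_n =
   if (n < 2 * l)%N then 0 else 'C(n.+1, l)%:R * 'C(n.+1 - l, n - 2 * l)%:R.
  move=> ln; have -> : geom K ^+ (2 + n.+1) *
     ((1 - 'X) ^+ (n.+1 - l) * 'X^2 ^+ l *+ 'C(n.+1, l)) =
     'X^(2 * l) * (((1 - 'X) * geom K) ^+ (n.+1 - l) * geom K ^+ l.+2)
       *+ 'C(n.+1, l).
    have -> : (2 + n.+1)%N = ((n.+1 - l) + l.+2)%N by lia.
    by rewrite exprD -exprM exprMn mulrnAr; congr (_ *+ _); ring.
  rewrite coefMn coefXnM; case: ltnP => nl; first by rewrite mul0rn.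
  have cancel B Q m : (m < K)%N -> (((1 - 'X) * geom K) ^+ B * Q)`_m = Q`_m.
    move=> mK; elim: B => [|B IH]; first by rewrite mul1r.
    by rewrite exprS -mulrA coef_geom_mul.
  rewrite cancel ?coef_geomX; try lia.
  by rewrite -[LHS]mulr_natl; congr (_ * 'C(_, _)%:R); lia.
rewrite (eq_bigr _ (fun (l : 'I_n.+2) _ => term l (ltn_ord l))).
rewrite (big_ord_widen n.+2
  (fun l => n.+1%:R * (binomz n (2 * l)%N * catalan l))); last by lia.
rewrite [RHS]big_mkcond; apply: eq_bigr => l _.
case: (ltnP n (2 * l)) => nl; first by rewrite ifF //; lia.
by rewrite ifT ?motzkin_term //; lia.
Qed.

(** * The sum r is the coefficient of M V^k *)

(** In the term i = n of r the correction [n = i] makes the quotient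
    (k+1)/(k+1) = 1, which is the constant term of V^k, also for k = 0. *)
Lemma r_conv (K n k : nat) : (1 < K)%N -> (n < K)%N ->
  r n k = \sum_(i < n.+1) motzkin i * V_coef K (n - i) k.
Proof.
move=> K1 nK; rewrite /r big_mkord; apply: eq_bigr => i _.
have le_in : (i <= n)%N by rewrite -ltnS.
have NK : (n - i < K)%N by apply: leq_ltn_trans nK; apply: leq_subr.
have NA : (n - i + k)%N%:Z = n%:Z + k%:Z - i%:Z by lia.
have N : (n - i)%N%:Z = n%:Z - i%:Z by lia.
have := @inner_sumE K (n - i) (n - i + k) NK.
rewrite NA N; have -> : (n - i + k)%N = (n + k - i)%N by lia.
move=> ->; rewrite -!mulrA; congr (_ * _).
have [eq_ni | ne_ni] := eqVneq n i.
  rewrite -eq_ni subnn addKn (V_coef01 K k K1).1 (coef_phiX01 K k K1).1.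
  by rewrite mulr1 divff // pnatr_eq0 addn1.
rewrite !addn0 mulrCA mulrA.
have nz : (n - i + k)%:R != 0 :> rat by rewrite pnatr_eq0; lia.
apply: (mulfI nz); rewrite V_coefE.
have -> : (n + k - i)%N = (n - i + k)%N by lia.
by rewrite !mulrA divff // mul1r.
Qed.

Lemma conv_V_rec (K : nat) (m : nat -> rat) : (1 < K)%N ->
  V_rec K (fun n k => \sum_(i < n.+1) m i * V_coef K (n - i) k).
Proof.
move=> K1 n k nK.
have V0 l : V_coef K 0 l = 1 by case: (V_coef01 K l K1).
have V1 l : V_coef K 1 l = 0 by case: (V_coef01 K l K1).
(* V has constant term 1 and no linear term, so the terms with i > n contribute
   amounts that are independent of the exponent of V and cancel. *)
have split1 l : \sum_(i < n.+2) m i * V_coef K (n.+1 - i) l =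
    \sum_(i < n.+1) m i * V_coef K (n - i).+1 l + m n.+1.
  rewrite big_ord_recr /= subnn V0 mulr1; congr (_ + _).
  by apply: eq_bigr => i _; rewrite subSn // -ltnS.
have split2 l : \sum_(i < n.+3) m i * V_coef K (n.+2 - i) l =
    \sum_(i < n.+1) m i * V_coef K (n - i).+2 l + m n.+2.
  rewrite big_ord_recr big_ord_recr /= subnn V0 mulr1 subSnn V1 mulr0 addr0.
  congr (_ + _); apply: eq_bigr => i _; have lein : (i <= n)%N by rewrite -ltnS.
  by rewrite !subSn // leqW.
rewrite !split1 !split2.
set a := \sum_(i < _) _; set b := \sum_(i < _) _; set c := \sum_(i < _) _.
set d := \sum_(i < _) _; set e := \sum_(i < _) _.
suff -> : a = b + (c - d) + e by ring.
rewrite -sumrB -!big_split; apply: eq_bigr => i _ /=.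
rewrite V_coef_rec; first by ring.
by apply: leq_ltn_trans nK; rewrite !ltnS leq_subr.
Qed.

Lemma r_MV_coef (K n k : nat) : (1 < K)%N -> (n < K)%N -> r n k = MV_coef K n k.
Proof.
move=> K1 nK; rewrite (r_conv K) //.
pose s n k := \sum_(i < n.+1) motzkin i * V_coef K (n - i) k.
have V0 l : V_coef K 0 l = 1 by case: (V_coef01 K l K1).
have V1 l : V_coef K 1 l = 0 by case: (V_coef01 K l K1).
have MV0 l : MV_coef K 0 l = 1 by case: (MV_coef01 K l K1).
have MV1 l : MV_coef K 1 l = 1 by case: (MV_coef01 K l K1).
have m0 : motzkin 0 = 1 by rewrite -(MV_coef_motzkin K) ?MV0 // ltnW.
have m1 : motzkin 1 = 1 by rewrite -(MV_coef_motzkin K) ?MV1.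
apply: (V_rec_uniq K s (MV_coef K)) nK => [||l|l|j jK _].
- exact: conv_V_rec.
- exact: MV_coef_rec.
- by rewrite /s big_ord1 V0 mulr1 m0 MV0.
- by rewrite /s big_ord_recr big_ord1 /= V0 V1 m1 MV1 mulr0 add0r mulr1.
rewrite /s big_ord_recr /= subnn V0 mulr1 MV_coef_motzkin //.
by rewrite big1 ?add0r // => i _; rewrite subSn -1?ltnS // V_coef_col0 mulr0.
Qed.

(** * Decomposition of the paths by their last steps *)

Lemma end_height_rcons (p : seq int) (s : int) :
  end_height (rcons p s) = end_height p + s.
Proof. by rewrite /end_height /height !take_size -cats1 big_cat big_seq1. Qed.

Lemma in_M2'_nil : in_M2' [::].
Proof. by split => // -[|//] _; rewrite /height big_nil. Qed.

Lemma in_M2'_rcons (p : seq int) (s : int) :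
  in_M2' (rcons p s) <->
  [/\ in_M2' p, -1 <= s, 0 <= end_height p + s
    & [|| nilp p, s == -1 | last 0 p == -1]].
Proof.
have take_p i : (i <= size p)%N -> take i (rcons p s) = take i p.
  by move=> ip; rewrite -cats1 takel_cat.
have stepE (x : int) :
    [|| up_step x, down_step x | horizontal_step x] = (-1 <= x).
  by rewrite /up_step /down_step /horizontal_step; lia.
have noD (x : int) : -1 <= x -> up_step x || horizontal_step x = (x != -1).
  by rewrite /up_step /horizontal_step; lia.
split=> [[st ht pr]|[[st ht pr] s1 hs ps]].
  have s1 : -1 <= s by rewrite -stepE st // mem_rcons mem_head.
  split=> //; [split|..].
  - by move=> x xp; apply: st; rewrite mem_rcons inE xp orbT.
  - move=> i ip; move: (ht i); rewrite /height take_p // size_rcons.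
    by apply; apply: leqW.
  - move=> i ip; move: (pr i); rewrite !nth_rcons size_rcons ip (ltnW ip).
    by apply; rewrite ltnS ltnW.
  - move: (ht (size p).+1); rewrite size_rcons -end_height_rcons.
    by rewrite /end_height size_rcons; exact.
  case: (lastP p) pr => [//|q x] /(_ (size q)).
  rewrite !size_rcons ltnSn => /(_ isT).
  rewrite !nth_rcons size_rcons !ltnSn !ltnn !eqxx last_rcons noD //.
  case: (s == -1) => [_ | /(_ isT)]; first by rewrite !orbT.
  by rewrite /down_step => ->; rewrite !orbT.
split.
- by move=> x; rewrite mem_rcons inE => /orP[/eqP->|/st //]; rewrite stepE.
- move=> i; rewrite size_rcons leq_eqVlt => /orP[/eqP->|ip].
    by move: hs; rewrite -end_height_rcons /end_height size_rcons.
  by rewrite /height take_p //; apply: ht.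
move=> i; rewrite size_rcons ltnS => ip; rewrite !nth_rcons ip.
case: ltnP => [ip1|pi]; first exact: pr.
have ip1 : i.+1 = size p by apply/eqP; rewrite eqn_leq ip.
rewrite ip1 eqxx noD // => sN1; move: ps; rewrite (negbTE sN1) /=.
case/orP => [|/eqP lastp]; first by case: (p) ip.
by rewrite -[i]succnK ip1 nth_last lastp.
Qed.

Lemma M2'_paths0 (k : nat) (p : seq int) :
  M2'_paths 0 k p <-> k = 0%N /\ p = [::].
Proof.
split=> [[_ /size0nil -> ]|[-> ->]].
  by rewrite /end_height /height big_nil; case: k.
by split; [exact: in_M2'_nil | | rewrite /end_height /height big_nil].
Qed.

Lemma M2'_paths1 (k : nat) (p : seq int) : M2'_paths 1 k p <-> p = [:: k%:Z].
Proof.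
have E s : end_height [:: s] = s by rewrite /end_height /height big_seq1.
split=> [[+ + +]|->].
  by case: p => [//|s [|//]] _ _; rewrite E => ->.
split; rewrite ?E //; apply/(in_M2'_rcons [::]); split=> //.
  exact: in_M2'_nil.
by rewrite /end_height /height big_nil add0r.
Qed.

Lemma M2'_paths_down (n k : nat) (p : seq int) :
  M2'_paths n.+1 k (rcons p (-1)) <-> M2'_paths n k.+1 p.
Proof.
rewrite /M2'_paths /= size_rcons end_height_rcons.
rewrite (propext (in_M2'_rcons _ _)) eqxx orbT.
split=> [[[Mp _ _ _] [<-] hp]|[Mp <- hp]]; split => //; try lia.
by split => //; lia.
Qed.

Lemma M2'_paths_nondown (n k : nat) (p : seq int) (s : int) : s != -1 ->
  M2'_paths n.+2 k (rcons p s) <->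
  exists h q, [/\ (h <= k)%N, p = rcons q (-1), s = k%:Z - h%:Z
                & M2'_paths n h.+1 q].
Proof.
move=> sN1; rewrite /M2'_paths /= size_rcons end_height_rcons.
rewrite (propext (in_M2'_rcons _ _)) (negbTE sN1).
split=> [[[Mp s1 _ pD] [szp] hp]|[h [q [hk -> -> Mq]]]].
  case: (lastP p) Mp szp hp pD => [//|q x] Mp szq hq.
  rewrite last_rcons /= => /orP[|/eqP x1]; first by rewrite /nilp size_rcons.
  move: Mp szq hq; rewrite {}x1 => Mp szq hq.
  have h0 : 0 <= end_height (rcons q (-1)).
    by case: Mp => _ /(_ (size (rcons q (-1))) (leqnn _)) + _; apply.
  exists (absz (end_height (rcons q (-1)))), q; split=> //; try lia.
  by apply/M2'_paths_down; split => //; lia.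
have [Mq1 szq hq] : M2'_paths n.+1 h (rcons q (-1)) by apply/M2'_paths_down.
split; [split=> //; try lia|by rewrite szq|lia].
by rewrite last_rcons eqxx !orbT.
Qed.

(** * Counting the paths *)

Fixpoint paths (n k : nat) : seq (seq int) :=
  match n with
  | 0 => if k == 0%N then [:: [::]] else [::]
  | n1.+1 =>
    match n1 with
    | 0 => [:: [:: k%:Z]]
    | n2.+1 =>
      [seq rcons p (-1) | p <- paths n1 k.+1] ++
      [seq rcons (rcons p (-1)) (k%:Z - h%:Z)
         | h <- iota 0 k.+1, p <- paths n2 h.+1]
    end
  end.

Lemma pathsSS (n k : nat) :
  paths n.+2 k =
  [seq rcons p (-1) | p <- paths n.+1 k.+1] ++
  [seq rcons (rcons p (-1)) (k%:Z - h%:Z)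
     | h <- iota 0 k.+1, p <- paths n h.+1].
Proof. by []. Qed.

Lemma mem_paths (n k : nat) (p : seq int) : p \in paths n k <-> M2'_paths n k p.
Proof.
elim/ltn_ind: n k p => -[|[|n]] IHn k p.
- rewrite M2'_paths0 /=; case: (k =P 0%N) => [->|k0].
    by rewrite inE; split => [/eqP|[_ ->]].
  by split=> // -[].
- by rewrite M2'_paths1 inE; split => /eqP.
rewrite pathsSS mem_cat; split.
  case/orP => [/mapP[q + ->]|/allpairsPdep[h [q [+ + ->]]]].
    by rewrite IHn // => Mq; apply/M2'_paths_down.
  rewrite mem_iota add0n ltnS IHn // => /= hk Mq.
  apply/M2'_paths_nondown; last by exists h, q.
  by lia.
case: (lastP p) => [[]//|q s] M; case: (s =P -1) M => [-> | /eqP sN1] M.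
  by apply/orP; left; apply: map_f; rewrite IHn //; apply/M2'_paths_down.
have [h [u [hk -> -> Mu]]] := (M2'_paths_nondown n k q s sN1).1 M.
apply/orP; right; apply/allpairsPdep; exists h, u; split => //.
  by rewrite mem_iota add0n.
by rewrite IHn.
Qed.

Lemma uniq_paths (n k : nat) : uniq (paths n k).
Proof.
elim/ltn_ind: n k => -[|[|n]] IHn k //; first by rewrite /=; case: eqP.
rewrite pathsSS cat_uniq map_inj_uniq ?IHn ?andTb //; last exact: rcons_injl.
apply/andP; split.
  (* k - h >= 0 is never a down step *)
  apply/hasPn => p /allpairsPdep[h [q [+ _ ->]]].
  rewrite mem_iota add0n ltnS => /= hk.
  by apply/mapP => -[u _ /rcons_inj[_]]; lia.
apply: allpairs_uniq_dep => [|h _|]; [exact: iota_uniq | exact: IHn |].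
move=> /= [h p] [h' p'] _ _ /= /rcons_inj[/rcons_inj[->] hh'].
by have -> : h = h' by lia.
Qed.

Lemma t_size_paths (n k : nat) : t n k = size (paths n k).
Proof.
rewrite /t.
have -> : M2'_paths n k = [set` [fset p in paths n k]%fset]%classic.
  apply/seteqP; split=> p /=.
    by move/mem_paths; rewrite in_fset.
  by rewrite in_fset => /mem_paths.
by rewrite set_fsetK card_fseq undup_id // uniq_paths.
Qed.

Lemma t_rec (n k : nat) :
  t n.+2 k = (t n.+1 k.+1 + \sum_(h < k.+1) t n h.+1)%N.
Proof.
rewrite !t_size_paths pathsSS size_cat size_map size_allpairs_dep.
congr (_ + _)%N.
rewrite sumnE big_map -[k.+1 in LHS]subn0 -/(index_iota 0 k.+1) big_mkord.
by apply: eq_bigr => h _; rewrite t_size_paths.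
Qed.

(** The difference of two consecutive instances of [t_rec]. *)
Lemma t_V_rec (K : nat) : V_rec K (fun n k => (t n.+1 k)%:R).
Proof.
move=> n k _.
by rewrite !(t_rec n.+1) !natrD big_ord_recr /= natrD; ring.
Qed.

Theorem corollary7 : forall n k : nat,
  (t n k)%:R = (if n == 0%N then (k == 0%N)%:R else r (n - 1) k) :> rat.
Proof.
case=> [|n] k; first by rewrite t_size_paths /=; case: eqP.
(* Row n is the last one compared; n + 2 leaves room for rows 0 and 1. *)
rewrite /= subn1 /= (r_MV_coef n.+2) //.
have t1 l : t 1 l = 1%N by rewrite t_size_paths.
have t2 l : t 2 l = 1%N.
  by rewrite t_rec t1 big1 // => h _; rewrite t_size_paths.
apply: (V_rec_uniq n.+2 (fun n k => (t n.+1 k)%:R) (MV_coef n.+2)) => //.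
- exact: t_V_rec.
- exact: MV_coef_rec.
- by move=> l; rewrite t1 (MV_coef01 _ l _).1.
- by move=> l; rewrite t2 (MV_coef01 _ l _).2.
move=> j jK IH; rewrite MV_coef_base_rec // -!IH // ?leqW //.
by rewrite t_rec big_ord1 natrD.
Qed.
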